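(* Let $F$ be a distribution function on $\mathbb{R}$ with finite second moment which is log-concave, in the sense that $\log F(x)$ is a concave function on $J=\{x\in\mathbb{R}:0<F(x)<1\}$, and which has no atom at its right end-point $\omega(F)=\inf\{x\in\mathbb{R}:F(x)=1\}$. Let $X_1,X_2,\dots$ be i.i.d. with distribution function $F$, $X_{k:k}=\max\{X_1,\dots,X_k\}$, and $Z_i=X_{i+1:i+1}-X_{i:i}$ for $i\ge1$. Then $\operatorname{Cov}[Z_i,Z_j]\le 0$ for all $n\ge2$ and all $i\neq j$ with $i,j\in\{1,\dots,n-1\}$; that is, $F$ belongs to the class NCP.
   Context: The class NCP consists of the distribution functions $F$ with finite second moment whose partial maxima spacings $Z_i=X_{i+1:i+1}-X_{i:i}$ (for an i.i.d. sequence from $F$) satisfy $\operatorname{Cov}[Z_i,Z_j]\le0$ for all $i\ne j$, $i,j=1,\dots,n-1$, for every $n\ge2$. *)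

(* Defs.v *)
From HB Require Import structures.
From mathcomp Require Import all_boot all_order all_algebra.
From mathcomp Require Import all_classical all_reals all_analysis.
Set Implicit Arguments. Unset Strict Implicit. Unset Printing Implicit Defensive.
Import Order.TTheory GRing.Theory Num.Theory.
Import numFieldNormedType.Exports.
Local Open Scope classical_set_scope.
Local Open Scope ring_scope.

Definition mutually_independent d (T : measurableType d) (R : realType)
    (P : probability T R) (X : nat -> {RV P >-> R}) : Prop :=
  forall (I : seq nat) (B : nat -> set R),
    uniq I -> (forall i, measurable (B i)) ->
    P (\bigcap_(i in [set` I]) (X i @^-1` B i)) =
    (\prod_(i <- I) P (X i @^-1` B i))%E.

(* Partial maximum X_{k:k} = max{X_1,...,X_k}; X_1,...,X_k are X 0,...,X (k-1).
   Only used for k >= 1. *)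
Definition pmax d (T : measurableType d) (R : realType) (P : probability T R)
    (X : nat -> {RV P >-> R}) (k : nat) : T -> R :=
  fun w => \big[Num.max/X 0%N w]_(i < k) X i w.

Definition spacing d (T : measurableType d) (R : realType) (P : probability T R)
    (X : nat -> {RV P >-> R}) (i : nat) : T -> R :=
  fun w => pmax X i.+1 w - pmax X i w.

Definition log_concave_df (R : realType) (F : R -> R) : Prop :=
  forall x y t, 0 < F x < 1 -> 0 < F y < 1 -> 0 <= t <= 1 ->
    t * ln (F x) + (1 - t) * ln (F y) <= ln (F (t * x + (1 - t) * y)).

(* Main.v *)
Require Import Defs.
From HB Require Import structures.
From mathcomp Require Import all_boot all_order all_algebra.
From mathcomp Require Import all_classical all_reals all_analysis.
From mathcomp Require Import measurable_realfun ring lra.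
Set Implicit Arguments. Unset Strict Implicit. Unset Printing Implicit Defensive.
Import Order.TTheory GRing.Theory Num.Theory.
Import numFieldNormedType.Exports.
Local Open Scope classical_set_scope.
Local Open Scope ring_scope.

(* With Z_i = [spacing X i] and M_i = [pmax X i], integrating the indicator of
   M_i <= x < M_(i+1) over x (Tonelli) gives E Z_i = int phi(F x) dx with
   phi t = t^i (1 - t), and, for i < j,
     E Z_i Z_j = int F(y)^j (1 - F y) A(y) dy,
     A(y) = int_{x < y} phi(F x / F y) dx.
   Log-concavity yields A(y) <= E Z_i, hence E Z_i Z_j <= E Z_i E Z_j.  Indeed
   phi is unimodal, so {phi o F > s} is an interval, and solving F z = F x / F y
   (F has no jumps above its left end-point) maps {x < y : phi(F x / F y) > s}
   into it without shrinking distances, because ln F z - ln F x is constant. *)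

(** * Unimodality of [t ^+ i * (1 - t)] and stretching under log-concavity *)

(** Weighted AM-GM for [i] copies of [a ^+ i.+1] and one of [b ^+ i.+1]. The induction step is [a]
    times the previous inequality plus the nonnegative term [ab]. *)
Lemma amgm_exprS (R : realFieldType) (i : nat) (a b : R) :
  0 <= a -> 0 <= b -> i.+1%:R * (a ^+ i * b) <= b ^+ i.+1 + i%:R * a ^+ i.+1.
Proof.
move=> a0 b0; elim: i => [|i IH]; first by rewrite expr0 !mul1r mul0r addr0.
have ab : 0 <= (b - a) * (b ^+ i.+1 - a ^+ i.+1).
  have [le_ab|/ltW le_ba] := leP a b.
    by rewrite mulr_ge0 ?subr_ge0 ?lerXn2r.
  by rewrite mulr_le0 ?subr_le0 ?lerXn2r.
have := ler_wpM2l a0 IH.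
rewrite -subr_ge0 => IH'; rewrite -subr_ge0.
have -> : b ^+ i.+2 + i.+1%:R * a ^+ i.+2 - i.+2%:R * (a ^+ i.+1 * b) =
  (a * (b ^+ i.+1 + i%:R * a ^+ i.+1) - a * (i.+1%:R * (a ^+ i * b))) +
  (b - a) * (b ^+ i.+1 - a ^+ i.+1).
  rewrite -(natr1 i.+1) -(natr1 i) !exprS; set u := a ^+ i; set v := b ^+ i.
  set n := i%:R; clear; ring.
exact: addr_ge0.
Qed.

(* [t ^+ i * (1 - t)] is maximal at [t = i / (i + 1)]; both branches compare
   it at [b] and at the end-point that lies on the other side of [b]. *)
Lemma minr_expr_onem (R : realFieldType) (i : nat) (a b c : R) :
  0 <= a -> a <= b -> b <= c ->
  Num.min (a ^+ i * (1 - a)) (c ^+ i * (1 - c)) <= b ^+ i * (1 - b).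
Proof.
move=> a0 ab bc; have b0 : 0 <= b := le_trans a0 ab.
move: b0; rewrite le_eqVlt => /predU1P[b0|b0].
  by rewrite ge_min; apply/orP; left; have -> : a = b by lra.
(* Multiplied by [i.+1%:R * b], the difference of the two values is exactly the assumed product plus
   the AM-GM gap between [x] and [b]. *)
have key x : 0 <= x -> 0 <= (i%:R - i.+1%:R * b) * (b ^+ i.+1 - x ^+ i.+1) ->
    x ^+ i * (1 - x) <= b ^+ i * (1 - b).
  move=> x0 h; rewrite -(ler_pM2l b0) -(@ler_pM2l _ i.+1%:R)// -subr_ge0.
  have := @amgm_exprS _ i _ _ x0 (ltW b0); rewrite -subr_ge0 => h'.
  have := addr_ge0 h h'; congr (0 <= _).
  rewrite -(natr1 i) !exprS; set u := x ^+ i; set v := b ^+ i.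
  set n := i%:R; clear; ring.
rewrite ge_min; have [h|/ltW h] := leP (i.+1%:R * b) i%:R; apply/orP.
  left; apply: key => //.
  by rewrite mulr_ge0 ?subr_ge0 ?lerXn2r// nnegrE ltW.
have c0 : 0 <= c by lra.
right; apply: key => //.
by rewrite mulr_le0 ?subr_le0 ?lerXn2r// nnegrE ltW.
Qed.

(* The points are compared through [F x2 / F x1 = F z2 / F z1]: [ln F] grows by
   the same amount on both intervals, and more slowly on the right one. *)
Lemma log_concave_df_stretch (R : realType) (F : R -> R) (c x1 x2 z1 z2 : R) :
  {homo F : x y / x <= y} -> log_concave_df F -> 0 < c < 1 ->
  0 < F x1 -> x1 <= x2 -> z1 <= z2 -> F z2 < 1 ->
  F x1 = c * F z1 -> F x2 = c * F z2 -> x2 - x1 <= z2 - z1.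
Proof.
move=> ndF lcF /andP[c0 c1] Fx1 x12 z12 Fz2 e1 e2.
have Fx2 : 0 < F x2 by apply: lt_le_trans (ndF _ _ x12).
have Fz1 : 0 < F z1 by move: Fx1; rewrite e1 pmulr_rgt0.
have Fz2' : 0 < F z2 by move: Fx2; rewrite e2 pmulr_rgt0.
have lt_xz1 : F x1 < F z1 by rewrite e1 gtr_pMl.
have lt_xz2 : F x2 < F z2 by rewrite e2 gtr_pMl.
have lt_inv u v : F u < F v -> u < v.
  by rewrite !ltNge; apply: contra => uv; exact: ndF.
have xz1 := lt_inv _ _ lt_xz1; have xz2 := lt_inv _ _ lt_xz2.
have Fz12 := ndF _ _ z12.
have D0 : 0 < z2 - x1 by lra.
have L1 : ln (F x1) = ln c + ln (F z1) by rewrite e1 lnM ?posrE.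
have L2 : ln (F x2) = ln c + ln (F z2) by rewrite e2 lnM ?posrE.
have lt12 : ln (F x1) < ln (F z2).
  by rewrite ltr_ln ?posrE// (lt_le_trans lt_xz1).
have J1 : 0 < F x1 < 1 by rewrite Fx1/= (lt_trans lt_xz1) ?(le_lt_trans Fz12).
have J2 : 0 < F z2 < 1 by rewrite Fz2'.
(* [t u] is the weight that writes [u] as a convex combination of the outer points [x1] and [z2];
   both [x2] and [z1] lie between them. *)
pose t u := (z2 - u) / (z2 - x1).
have tE u : t u * x1 + (1 - t u) * z2 = u.
  by rewrite /t; field; lra.
have ln_ge u : x1 <= u <= z2 ->
    t u * ln (F x1) + (1 - t u) * ln (F z2) <= ln (F u).
  move=> /andP[xu uz]; rewrite -{3}(tE u); apply: lcF => //.
  rewrite /t divr_ge0 ?(ltW D0) ?subr_ge0//= ler_pdivrMr// mul1r.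
  lra.
have H1 : t x2 * ln (F x1) + (1 - t x2) * ln (F z2) <= ln (F x2).
  by apply: ln_ge; lra.
have H2 : t z1 * ln (F x1) + (1 - t z1) * ln (F z2) <= ln (F z1).
  by apply: ln_ge; lra.
(* Add [H1] and [H2]: by [L1] and [L2], [ln (F x2) + ln (F z1) = ln (F x1) + ln (F z2)]. Dividing by
   the positive increment leaves [1 <= t x2 + t z1], which is the claim. *)
have : 0 <= (t x2 + t z1 - 1) * (ln (F z2) - ln (F x1)) by lra.
rewrite pmulr_lge0 ?subr_gt0// /t -mulrDl subr_ge0 ler_pdivlMr// mul1r; lra.
Qed.

(** * Tonelli for gaps, and comparison of Lebesgue measures and integrals *)

Lemma measurable_le_lt d (T : measurableType d) (R : realType) (U V W : T -> R) :
  measurable_fun [set: T] U -> measurable_fun [set: T] V ->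
  measurable_fun [set: T] W -> measurable [set w | U w <= W w < V w].
Proof.
move=> mU mV mW.
have -> : [set w | U w <= W w < V w] = (setT `&` [set w | U w <= W w]) `&`
    ~` (setT `&` [set w | V w <= W w]).
  rewrite !setTI; apply/seteqP; split => w /=.
    by case/andP => -> WV; split => //; apply/negP; rewrite -ltNge.
  by case=> -> /negP; rewrite -ltNge.
by apply: measurableI; [|apply: measurableC]; exact: measurable_fun_le.
Qed.

(** [V w - U w] is the length of [[U w, V w[], hence the integral over [x] of its indicator; Tonelli
    then swaps [w] and [x]. The weight [h] will carry the other factor of a product of spacings. *)
Lemma integral_weighted_gap d (T : measurableType d) (R : realType)
    (mu : {sigma_finite_measure set T -> \bar R})
    (h : T -> \bar R) (U V : T -> R) :
  measurable_fun [set: T] h -> measurable_fun [set: T] U -> measurable_fun [set: T] V ->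
  (forall w, 0 <= h w)%E -> (forall w, U w <= V w) ->
  (\int[mu]_w (h w * (V w - U w)%:E) =
   \int[lebesgue_measure]_x \int[mu]_(w in [set w | (U w <= x < V w)%R]) h w)%E.
Proof.
move=> mh mU mV h0 UV.
pose A : set (T * measurableTypeR R) := [set p | U p.1 <= p.2 < V p.1].
have mA : measurable A.
  by apply: measurable_le_lt => //; exact: measurableT_comp.
pose f (p : T * measurableTypeR R) := (h p.1 * (\1_A p)%:E)%E.
have mf : measurable_fun setT f.
  apply: emeasurable_funM; first exact: measurableT_comp.
  exact/measurable_EFinP/measurable_indic.
have f0 p : (0 <= f p)%E by rewrite mule_ge0// lee_fin.
transitivity (\int[mu]_w \int[lebesgue_measure]_x f (w, x))%E.
  apply: eq_integral => w _; rewrite /f/= ge0_integralZl//; last first.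
    apply/measurable_EFinP.
    have := measurableT_comp (@measurable_indic _ _ R setT _ mA) (pair1_measurable w).
    exact.
  congr (_ * _)%E.
  rewrite (_ : (fun x => _) = fun x => (\1_`[U w, V w[%classic x)%:E); last first.
    apply/funext => x; rewrite !indicE.
    suff -> : ((w, x) \in A) = (x \in `[U w, V w[%classic) by [].
    by apply/idP/idP; rewrite !inE /A/= in_itv.
  rewrite integral_indic//= setIT lebesgue_measure_itv/= lte_fin.
  by have := UV w; rewrite le_eqVlt => /predU1P[->|->]; rewrite ?ltxx ?subrr.
rewrite (fubini_tonelli f)//; apply: eq_integral => x _.
rewrite [RHS]integral_mkcond; apply: eq_integral => w _; rewrite /f/= patchE indicE.
rewrite (_ : ((w, x) \in A) = (w \in [set w | U w <= x < V w])).
  by case: ifP; rewrite ?mule1 ?mule0.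
by apply/idP/idP; rewrite !inE.
Qed.

Lemma integral_gap d (T : measurableType d) (R : realType)
    (mu : {sigma_finite_measure set T -> \bar R}) (U V : T -> R) :
  measurable_fun [set: T] U -> measurable_fun [set: T] V -> (forall w, U w <= V w) ->
  (\int[mu]_w (V w - U w)%:E =
   \int[lebesgue_measure]_x mu [set w | (U w <= x < V w)%R])%E.
Proof.
move=> mU mV UV.
have /= := @integral_weighted_gap _ _ _ mu (cst 1%E) _ _ (measurable_cst _) mU mV
  (fun=> lee01) UV.
under eq_integral do rewrite mul1e.
move=> ->; apply: eq_integral => x _; rewrite integral_cst ?mul1e//.
exact: measurable_le_lt.
Qed.

(** [A] lies in [[inf A, sup A]], whose length is its diameter, and every distance in [A] is at most
    the length of a segment inside the interval [B]. *)
Lemma le_lebesgue_measure_diam (R : realType) (A B : set R) :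
  measurable A -> is_interval B ->
  (forall x1 x2, A x1 -> A x2 -> x1 <= x2 ->
     exists z1 z2, [/\ B z1, B z2, z1 <= z2 & x2 - x1 <= z2 - z1]) ->
  (lebesgue_measure A <= lebesgue_measure B)%E.
Proof.
move=> mA iB AB.
have mB : measurable B by exact: is_interval_measurable.
have [->|/set0P[a Aa]] := eqVneq A set0; first by rewrite measure0.
have AB' x1 x2 : A x1 -> A x2 -> ((x2 - x1)%:E <= lebesgue_measure B)%E.
  move=> A1 A2; have [/ltW x21|x12] := ltP x2 x1.
    by apply: (@le_trans _ _ 0%E) => //; rewrite lee_fin subr_le0.
  have [z1 [z2 [B1 B2 z12 le_xz]]] := AB _ _ A1 A2 x12.
  apply: (@le_trans _ _ (lebesgue_measure `[z1, z2]%classic)).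
    rewrite lebesgue_measure_itv/= lte_fin.
    move: z12; rewrite le_eqVlt => /predU1P[z12|->]; last by rewrite lee_fin.
    by move: le_xz; rewrite z12 ltxx subrr lee_fin.
  rewrite le_measure ?inE// => z; rewrite /= in_itv/= => zz; exact: (iB z1 z2).
have [->|Bfin] := eqVneq (lebesgue_measure B) +oo%E; first exact: leey.
have Bl : lebesgue_measure B = (fine (lebesgue_measure B))%:E.
  by rewrite fineK// ge0_fin_numE// ltey.
move: Bl AB'; move: (fine _) => l Bl; rewrite Bl => AB'.
have A_ub x1 x2 : A x1 -> A x2 -> x2 <= x1 + l.
  by move=> A1 A2; have := AB' _ _ A1 A2; rewrite lee_fin; lra.
have supA : has_sup A.
  by split; [exists a|exists (a + l) => x Ax; exact: A_ub].
have infA : has_inf A.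
  by split; [exists a|exists (a - l) => x Ax; rewrite lerBlDr A_ub].
have sup_inf : sup A - inf A <= l.
  rewrite lerBlDl -lerBlDr; apply: lb_le_inf; first by exists a.
  move=> x Ax; rewrite lerBlDr; apply: ge_sup; first by exists a.
  by move=> x' Ax'; exact: A_ub.
apply: (@le_trans _ _ (lebesgue_measure `[inf A, sup A]%classic)).
  rewrite le_measure ?inE// => x Ax; rewrite /= in_itv/=.
  by rewrite ge_inf ?ub_le_sup//; [case: supA|case: infA].
rewrite lebesgue_measure_itv/= lte_fin; case: ifP => _; rewrite lee_fin//.
by have := A_ub a a Aa Aa; lra.
Qed.

(** The integral of a nonnegative function is a supremum over the simple functions below it, so this
    covers integrands whose measurability has not been established, such as measures of level
    sets. *)
Lemma ge0_integral_mono d (T : measurableType d) (R : realType)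
    (mu : {measure set T -> \bar R}) (f g : T -> \bar R) :
  (forall x, 0 <= f x)%E -> (forall x, f x <= g x)%E ->
  (\int[mu]_x f x <= \int[mu]_x g x)%E.
Proof.
move=> f0 fg; have g0 x : (0 <= g x)%E := le_trans (f0 x) (fg x).
rewrite !ge0_integralTE//; apply: ereal_sup_le => _ [h hf <-].
by exists h => // x; exact: le_trans (hf x) (fg x).
Qed.

(** This is the bound [A(y) <= E Z_i]. Both integrals are written as integrals over levels [s] of
    the measures of superlevel sets, which are compared for each [s]. *)
Lemma le_integral_rescaled_df (R : realType) (F : R -> R) (i : nat) (y : R) :
  (0 < i)%N -> {homo F : x y / x <= y} -> (forall x, 0 <= F x <= 1) ->
  log_concave_df F ->
  (forall x v, 0 < F x -> F x <= v < 1 -> exists z, F z = v) ->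
  0 < F y < 1 ->
  (\int[lebesgue_measure]_(x in `]-oo, y[) ((F x / F y) ^+ i * (1 - F x / F y))%:E
   <= \int[lebesgue_measure]_x (F x ^+ i * (1 - F x))%:E)%E.
Proof.
move=> i0 ndF F01 lcF ivF /andP[Fy0 Fy1].
have phi_ge0 (t : R) : 0 <= t <= 1 -> 0 <= t ^+ i * (1 - t).
  by move=> /andP[t0 t1]; rewrite mulr_ge0 ?exprn_ge0 ?subr_ge0.
have mF : measurable_fun [set: R] F by exact: nondecreasing_measurable.
pose phi (t : R) : R := t ^+ i * (1 - t).
have mphi : measurable_fun [set: R] phi.
  apply: measurable_funM; first exact: measurable_funX.
  by apply: measurable_funB.
pose G x := if x < y then phi (F x / F y) else 0.
have FxFy x : x < y -> 0 <= F x / F y <= 1.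
  move=> xy; have /andP[F0 _] := F01 x.
  by rewrite divr_ge0 ?(ltW Fy0)//= ler_pdivrMr// mul1r ndF// ltW.
have G0 x : 0 <= G x.
  by rewrite /G; case: ifPn => // xy; exact/phi_ge0/FxFy.
have mG : measurable_fun [set: R] G.
  apply: measurable_fun_ifT => //.
    exact: measurable_fun_ltr.
  apply: measurableT_comp => //.
  by apply: measurable_funM.
have mH : measurable_fun [set: R] (phi \o F) by exact: measurableT_comp.
have -> : (\int[lebesgue_measure]_(x in `]-oo, y[)
    ((F x / F y) ^+ i * (1 - F x / F y))%:E =
    \int[lebesgue_measure]_x (G x - 0)%:E)%E.
  rewrite integral_mkcond; apply: eq_integral => x _; rewrite patchE subr0 /G.
  have -> : (x \in (`]-oo, y[%classic : set R)) = (x < y).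
    by apply/idP/idP; rewrite !inE/= in_itv.
  by case: ifP.
have -> : (\int[lebesgue_measure]_x (F x ^+ i * (1 - F x))%:E =
    \int[lebesgue_measure]_x ((phi \o F) x - 0)%:E)%E.
  by apply: eq_integral => x _; rewrite subr0.
rewrite (@integral_gap _ (measurableTypeR R) R lebesgue_measure)//.
rewrite (@integral_gap _ (measurableTypeR R) R lebesgue_measure)//; last first.
  by move=> x; exact/phi_ge0/F01.
apply: ge0_integral_mono => // s.
case: (boolP (s < 0)) => [s_lt0|]; last rewrite -leNgt => s0.
  rewrite [X in (lebesgue_measure X <= _)%E](_ : _ = set0) ?measure0//.
  by rewrite -subset0 => x /= /andP[]; rewrite leNgt s_lt0.
apply: le_lebesgue_measure_diam.
- exact: measurable_le_lt.
(* The superlevel set of [phi \o F] is an interval: [phi] at a middle point is at least the smaller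
   of its two outer values. *)
- move=> u w /=; rewrite s0/= => su sw v /andP[uv vw].
  have /andP[Fu0 _] := F01 u.
  have := @minr_expr_onem _ i _ _ _ Fu0 (ndF _ _ uv) (ndF _ _ vw).
  by apply: lt_le_trans; rewrite lt_min su sw.
(* [s < G x] with [0 <= s] forces [phi (F x / F y) > 0], hence [0 < F x] (as [0 < i]) and
   [F x / F y < 1]. Since also [F x <= F x / F y], the intermediate value hypothesis provides
   [z]. *)
have shift x : s < G x -> exists2 z, s < phi (F z) &
    [/\ 0 < F x, F z < 1 & F x = F y * F z].
  rewrite /G; case: ifPn => [xy|_]; last by rewrite ltNge s0.
  move=> sx; have phi_gt0 := le_lt_trans s0 sx.
  have /andP[t0 t1] := FxFy x xy.
  have Fx0 : 0 < F x.
    have /andP[+ _] := F01 x; rewrite le_eqVlt => /predU1P[Fx|//].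
    by move: phi_gt0; rewrite /phi -Fx mul0r expr0n (gtn_eqF i0) /= mul0r ltxx.
  have lt_t1 : F x / F y < 1.
    rewrite lt_neqAle t1 andbT; apply/eqP => t_eq1.
    by move: phi_gt0; rewrite /phi t_eq1 subrr mulr0 ltxx.
  have [z Fz] : exists z, F z = F x / F y.
    apply: (ivF x) => //; rewrite lt_t1 andbT ler_pdivlMr//.
    by rewrite ger_pMr// ltW.
  by exists z; rewrite Fz//; split => //; rewrite mulrC divfK// gt_eqF.
move=> x1 x2 /= /andP[_ /shift[z1 sz1 [Fx1 Fz1 e1]]].
move=> /andP[_ /shift[z2 sz2 [Fx2 Fz2 e2]]] x12.
have Fy01 : 0 < F y < 1 by rewrite Fy0.
have [z12|z21] := leP z1 z2.
  exists z1, z2; rewrite s0/=; split => //.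
  exact: (@log_concave_df_stretch _ F (F y)).
(* The chosen preimages may come in the wrong order if [F] is flat between them; then [F z1 = F z2]
   and one point serves for both. *)
exists z1, z1; rewrite s0/=; split => //.
have Fz12 : F z1 = F z2.
  apply: le_anti; rewrite (ndF _ _ (ltW z21)) andbT.
  by rewrite -(ler_pM2l Fy0) -e1 -e2 ndF.
by apply: (@log_concave_df_stretch _ F (F y)) => //; rewrite Fz12.
Qed.

(** * Distribution functions, and absence of jumps under log-concavity *)

Section distribution_function.
Context d (T : measurableType d) (R : realType) (P : probability T R).
Variables (Y : {RV P >-> R}) (F : R -> R).
Hypothesis YF : forall x, P [set w | Y w <= x] = (F x)%:E.

Let cdfE : cdf Y = EFin \o F.
Proof.
apply/funext => x /=; rewrite -YF /cdf /distribution /pushforward.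
by congr (P _); apply/seteqP; split => w /=; rewrite in_itv.
Qed.


Lemma df_nondecreasing : {homo F : x y / x <= y}.
Proof. by move=> x y /(cdf_nondecreasing Y); rewrite cdfE/= lee_fin. Qed.

Lemma df_itv01 x : 0 <= F x <= 1.
Proof.
by have := cdf_le1 Y x; have := cdf_ge0 Y x; rewrite cdfE/= !lee_fin => -> ->.
Qed.

Lemma df_gt v : v < 1 -> exists x, v < F x.
Proof.
move=> v1; have F1 : F x @[x --> +oo] --> (1 : R).
  by have := cvg_cdfy1 Y; rewrite cdfE => /fine_cvg.
have : \forall x \near +oo, v < F x by exact: cvgr_gt F1 _ v1.
exact: filter_ex.
Qed.

Lemma df_right_lt x v : F x < v -> exists2 y, x < y & F y < v.
Proof.
move=> Fxv; have Fx : F y @[y --> x^'+] --> F x.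
  by have := @cdf_right_continuous _ _ _ _ Y x; rewrite cdfE => /fine_cvg.
have h : \forall y \near x^'+, F y < v by exact: cvgr_lt Fx _ Fxv.
have /filter_ex[y [xy Fy]] : \forall y \near x^'+, x < y /\ F y < v.
  by near=> y; split; near: y => //; exact: nbhs_right_gt.
by exists y.
Unshelve. all: by end_near. Qed.

(** The event is the increasing union of the events [Y w <= x - n.+1%:R^-1], so a bound on [F] to
    the left of [x] passes to the limit. *)
Lemma prob_lt_le x v : (forall y, y < x -> F y <= v) ->
  (P [set w | (Y w < x)%R] <= v%:E)%E.
Proof.
move=> Fv; pose A n := [set w | Y w <= x - n.+1%:R^-1].
have mA n : measurable (A n).
  rewrite (_ : A n = Y @^-1` `]-oo, x - n.+1%:R^-1]).
    exact: measurable_funPTI.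
  by apply/seteqP; split => w; rewrite /A/= in_itv.
have -> : [set w | Y w < x] = \bigcup_n A n.
  apply/seteqP; split => w /=.
    rewrite -subr_gt0 => Yx; exists (Num.truncn (x - Y w)^-1) => //; rewrite /A/=.
    rewrite lerBrDl -lerBrDr -[leRHS]invrK lef_pV2 ?posrE ?invr_gt0//.
    exact/ltW/truncnS_gt.
  by move=> [n _]; rewrite /A/= => /le_lt_trans; apply; rewrite gtrBl invr_gt0.
have cv : (P \o A) n @[n --> \oo] --> P (\bigcup_n A n).
  apply: nondecreasing_cvg_mu => //; first exact: bigcup_measurable.
  move=> n m nm; apply/subsetPset => w; rewrite /A/= => /le_trans; apply.
  by rewrite lerD2l lerN2 lef_pV2 ?posrE// ler_nat.
rewrite -(cvg_lim _ cv)//; apply: lime_le; first by apply/cvg_ex; eexists; exact: cv.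
by apply: nearW => n /=; rewrite YF lee_fin; apply: Fv; rewrite gtrBl invr_gt0.
Qed.

(** The value is attained at the infimum of [{z | v <= F z}]: right-continuity gives [v <= F] there,
    and a strict inequality would be a jump. Log-concavity excludes it where [F < 1], the absence of
    an atom where [F = 1]. *)
Lemma df_intermediate : log_concave_df F ->
  ((exists x, F x = 1) -> P (Y @^-1` [set inf [set x | F x = 1]]) = 0%E) ->
  forall x v, 0 < F x -> F x <= v < 1 -> exists z, F z = v.
Proof.
move=> lcF atom x v Fx0 /andP[+ v1]; rewrite le_eqVlt => /predU1P[<-|Fxv].
  by exists x.
have ndF := df_nondecreasing.
have lt_inv u w : F u < F w -> u < w.
  by rewrite !ltNge; apply: contra => uw; exact: ndF.
pose S := [set z | v <= F z].
have S0 : S !=set0 by have [z /ltW] := df_gt v1; exists z.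
have Sx : lbound S x.
  by move=> z Sz; apply/ltW/lt_inv/(lt_le_trans Fxv).
have Slt z : z < inf S -> F z < v.
  by rewrite !ltNge; apply: contra => Fz; apply: ge_inf => //; exists x.
have vF : v <= F (inf S).
  rewrite leNgt; apply/negP => /df_right_lt[y /(inf_lt S0)[z Sz zy]].
  by rewrite ltNge (le_trans Sz) ?ndF// ltW.
exists (inf S); apply/eqP; rewrite eq_le vF andbT leNgt; apply/negP => Fv.
have v0 : 0 < v := lt_trans Fx0 Fxv.
have FS0 := lt_trans v0 Fv.
(* If [F (inf S) = 1], then [inf S] is the right end-point; without an atom there, [Y < inf S] has
   probability 1, although it is at most [v < 1]. *)
have /andP[_] := df_itv01 (inf S); rewrite le_eqVlt => /predU1P[F1|F1].
  have infE : inf [set z | F z = 1] = inf S.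
    apply: le_anti; rewrite ge_inf//=; last first.
      by exists x => z /= Fz; apply: Sx; rewrite /S/= Fz ltW.
    apply: lb_le_inf; first by exists (inf S).
    move=> z /= Fz; apply: ge_inf; first by exists x.
    by rewrite /S/= Fz ltW.
  have := atom (ex_intro _ _ F1); rewrite infE => P0.
  have : (P [set w | (Y w < inf S)%R] <= v%:E)%E.
    by apply: prob_lt_le => z /Slt/ltW.
  have -> : P [set w | Y w < inf S] = 1%E.
    have mlt : measurable [set w | Y w < inf S].
      rewrite (_ : [set w | _] = Y @^-1` `]-oo, inf S[).
        exact: measurable_funPTI.
      by apply/seteqP; split => w; rewrite /= in_itv.
    have <- : P [set w | Y w <= inf S] = 1%E by rewrite YF F1.
    have -> : [set w | Y w <= inf S] =
        [set w | Y w < inf S] `|` Y @^-1` [set inf S].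
      apply/seteqP; split => w /=; rewrite le_eqVlt.
        by case/predU1P; [right|left].
      by case=> [->|->]; rewrite ?eqxx ?orbT.
    rewrite measureU//; first by rewrite [X in (_ + X)%E]P0 adde0.
    by rewrite -subset0 => w /= [/[swap] ->]; rewrite ltxx.
  by rewrite lee_fin leNgt v1.
have x_lt : x < inf S by apply: lt_inv; exact: lt_trans Fv.
have Jx : 0 < F x < 1 by rewrite Fx0 (lt_trans Fxv).
have JS : 0 < F (inf S) < 1 by rewrite FS0.
have Lx : ln (F x) < ln v by rewrite ltr_ln ?posrE.
have LS : ln v < ln (F (inf S)) by rewrite ltr_ln ?posrE.
(* on the segment from [x] up to [inf S] the values stay below [v] *)
pose t := (ln (F (inf S)) - ln v) / (2 * (ln (F (inf S)) - ln (F x))).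
have D0 : 0 < ln (F (inf S)) - ln (F x) by lra.
have t0 : 0 < t by rewrite divr_gt0 ?mulr_gt0//; lra.
have t1 : t <= 1 by rewrite ler_pdivrMr ?mulr_gt0//; lra.
have := lcF x (inf S) t Jx JS; rewrite (ltW t0) t1 => /(_ isT).
set z := t * x + _ => Lz.
have z_lt : z < inf S.
  have : 0 < t * (inf S - x) by rewrite mulr_gt0// subr_gt0.
  by rewrite /z; lra.
have Fz0 : 0 < F z.
  apply: (lt_le_trans Fx0); apply: ndF.
  have : 0 <= (1 - t) * (inf S - x) by rewrite mulr_ge0 ?subr_ge0// ltW.
  by rewrite /z; lra.
have : ln (F z) < ln v by rewrite ltr_ln ?posrE// Slt.
(* By the choice of [t], the chord of [ln F] at [z] is the midpoint of [ln v] and [ln (F (inf S))],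
   so [Lz] puts [ln (F z)] above [ln v]. *)
have : t * (ln (F (inf S)) - ln (F x)) = (ln (F (inf S)) - ln v) / 2.
  by rewrite /t invfM mulrA divfK ?gt_eqF.
lra.
Qed.

End distribution_function.

(** * Partial maxima and the level-crossing events *)

Section partial_maxima.
Context d (T : measurableType d) (R : realType) (P : probability T R).
Variables (X : nat -> {RV P >-> R}).

Lemma pmaxS k w : pmax X k.+1 w = Num.max (pmax X k w) (X k w).
Proof.
apply: le_anti; rewrite /pmax ge_max; apply/and3P; split.
- apply/bigmax_leP; split; first by rewrite le_max bigmax_ge_id.
  move=> [i /= lt_ik] _; rewrite le_max; move: lt_ik; rewrite ltnS leq_eqVlt.
  case/predU1P=> [->|lt_ik]; first by rewrite lexx orbT.
  by rewrite (le_bigmax_cond _ (fun i : 'I_k => X i w) (j := Ordinal lt_ik)).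
- apply/bigmax_leP; split; first exact: bigmax_ge_id.
  move=> i _.
  exact: (le_bigmax_cond _ (fun i : 'I_k.+1 => X i w) (j := widen_ord (leqnSn k) i)).
- exact: (le_bigmax_cond _ (fun i : 'I_k.+1 => X i w) (j := ord_max)).
Qed.

Lemma pmax_leP k w x : (0 < k)%N ->
  (pmax X k w <= x) <-> (forall i, (i < k)%N -> X i w <= x).
Proof.
elim: k => // -[_ _|k IH _].
  rewrite pmaxS /pmax big_ord0 maxxx; split => [Xx [|//] //|]; exact.
rewrite pmaxS ge_max; split.
  case/andP => /IH Mx Xx i; rewrite ltnS leq_eqVlt => /predU1P[->//|]; exact: Mx.
move=> Xx; rewrite Xx// andbT; apply/IH => // i ik; apply: Xx; exact: ltnW.
Qed.

Lemma pmax_leS k w : pmax X k w <= pmax X k.+1 w.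
Proof. by rewrite pmaxS le_max lexx. Qed.

Lemma measurable_pmax k : measurable_fun [set: T] (pmax X k).
Proof.
elim: k => [|k IH].
  have -> : pmax X 0 = X 0%N by apply/funext => w; rewrite /pmax big_ord0.
  by [].
have -> : pmax X k.+1 = pmax X k \max X k by apply/funext => w; rewrite pmaxS.
exact: measurable_maxr.
Qed.

Lemma spacing_ge0 k w : 0 <= spacing X k w.
Proof. by rewrite subr_ge0 pmax_leS. Qed.

Lemma measurable_spacing k : measurable_fun [set: T] (spacing X k).
Proof. by apply: measurable_funB; exact: measurable_pmax. Qed.

(** For [0 < k], the event that [X k] is the first observation above the level [x]. The measure of
    the levels at which it occurs is the [k]-th spacing. *)
Definition record_at k x := [set w | pmax X k w <= x < pmax X k.+1 w].

Lemma measurable_record_at k x : measurable (record_at k x).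
Proof. by apply: measurable_le_lt => //; exact: measurable_pmax. Qed.

Lemma record_atP k x w : (0 < k)%N ->
  record_at k x w <-> (forall i, (i < k)%N -> X i w <= x) /\ x < X k w.
Proof.
move=> k0; rewrite /record_at/=; split.
  case/andP => Mx; rewrite pmaxS lt_max ltNge Mx/=; split => //.
  exact/pmax_leP.
case=> Xx xX; apply/andP; split; first exact/pmax_leP.
by rewrite pmaxS lt_max xX orbT.
Qed.

Variable F : R -> R.
Hypothesis indep : mutually_independent X.
Hypothesis XF : forall i x, P [set w | X i w <= x] = (F x)%:E.

Let preim_le i x : X i @^-1` `]-oo, x] = [set w | X i w <= x].
Proof. by apply/seteqP; split => w /=; rewrite in_itv. Qed.

Lemma prob_preim_gt i x : P (X i @^-1` `]x, +oo[) = (1 - F x)%:E.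
Proof.
rewrite EFinB -(XF i) -preim_le -probability_setC; last exact: measurable_funPTI.
by congr (P _); apply/seteqP; split => w /=; rewrite !in_itv/= andbT ltNge => /negP.
Qed.

Lemma prob_preim_itv i x y : x <= y ->
  P (X i @^-1` `]x, y]) = (F y - F x)%:E.
Proof.
move=> xy; rewrite EFinB -!(XF i) -!preim_le.
rewrite [X in (_ - P X)%E](_ : _ = X i @^-1` `]-oo, y] `&` X i @^-1` `]-oo, x]).
  rewrite -measureD; [|exact: measurable_funPTI|exact: measurable_funPTI|].
    congr (P _); apply/seteqP; split => w /=; rewrite !in_itv/= ltNge.
      by case/andP => /negP.
    by case=> -> /negP ->.
  by rewrite ltey_eq fin_num_measure//; exact: measurable_funPTI.
by rewrite setIidr// => w /=; rewrite !in_itv/= => /le_trans; exact.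
Qed.

Lemma prob_forall_mem n (B : nat -> set R) (b : nat -> R) :
  (forall k, measurable (B k)) -> (forall k, P (X k @^-1` B k) = (b k)%:E) ->
  P [set w | forall k, (k < n)%N -> B k (X k w)] = (\prod_(0 <= k < n) b k)%:E.
Proof.
move=> mB Bb; have := indep (iota_uniq 0 n) mB.
rewrite (eq_bigr (fun k => (b k)%:E))// prodEFin /index_iota subn0 => <-.
congr (P _); apply/seteqP; split => w /= Bw k /=.
  by rewrite mem_iota/= add0n; exact: Bw.
by move=> kn; apply: Bw; rewrite /= mem_iota.
Qed.

Lemma prob_record_at i x : (0 < i)%N ->
  P (record_at i x) = (F x ^+ i * (1 - F x))%:E.
Proof.
move=> i0.
pose B k := [set` if (k < i)%N then `]-oo, x] else `]x, +oo[].
pose b k := if (k < i)%N then F x else 1 - F x.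
have -> : record_at i x = [set w | forall k, (k < i.+1)%N -> B k (X k w)].
  apply/seteqP; split => w; rewrite record_atP//=.
    case=> Xx xX k; rewrite ltnS leq_eqVlt /B => /predU1P[->|ki].
      by rewrite ltnn /= in_itv/= xX.
    by rewrite ki/= in_itv/= Xx.
  move=> h; split.
    by move=> k ki; have := h k (ltnW ki); rewrite /B ki/= in_itv.
  by have := h i (ltnSn i); rewrite /B ltnn/= in_itv/= andbT.
rewrite (@prob_forall_mem _ B b).
- rewrite big_nat_recr//= {2}/b ltnn; congr (_ * _)%:E.
  rewrite (eq_big_nat _ _ (F2 := fun=> F x)) ?prodr_const_nat ?subn0//.
  by move=> k /andP[_ ki]; rewrite /b ki.
- by move=> k; rewrite /B; case: ifP.
- move=> k; rewrite /B /b; case: ifP => _; last exact: prob_preim_gt.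
  by rewrite preim_le.
Qed.

(** Independence over four groups: the [i] first variables are at most [x], [X i] is in []x, y]],
    the [j - i.+1] variables strictly between are at most [y], and [X j] exceeds [y]. *)
Lemma prob_record_atI i j x y : (0 < i)%N -> (i < j)%N -> x < y ->
  P (record_at j y `&` record_at i x) =
  (F x ^+ i * (F y - F x) * F y ^+ (j - i.+1) * (1 - F y))%:E.
Proof.
move=> i0 ij xy; have j0 : (0 < j)%N := leq_trans i0 (ltnW ij).
pose B k := [set` if (k < i)%N then `]-oo, x] else
  if k == i then `]x, y] else if (k < j)%N then `]-oo, y] else `]y, +oo[].
pose b k := if (k < i)%N then F x else if k == i then F y - F x else
  if (k < j)%N then F y else 1 - F y.
have -> : record_at j y `&` record_at i x =
    [set w | forall k, (k < j.+1)%N -> B k (X k w)].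
  apply/seteqP; split => w /=; rewrite !record_atP//=.
    move=> [[Xy yX] [Xx xX]] k; rewrite ltnS leq_eqVlt /B => /predU1P[->|kj].
      by rewrite ltnNge (ltnW ij)/= (gtn_eqF ij) ltnn /= in_itv/= yX.
    case: ifPn => [ki|_]; first by rewrite /= in_itv/= Xx.
    case: eqP => [->|_]; first by rewrite /= in_itv/= xX Xy.
    by rewrite kj /= in_itv/= Xy.
  move=> h; have hi := h i (leqW ij); have hj := h j (ltnSn j).
  move: hi hj; rewrite /B ltnn eqxx /= in_itv/= => /andP[xXi Xiy].
  rewrite ltnNge (ltnW ij)/= (gtn_eqF ij) ltnn /= in_itv/= andbT => yXj.
  have Xx k : (k < i)%N -> X k w <= x.
    move=> ki; have := h k (leqW (ltn_trans ki ij)).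
    by rewrite /B ki /= in_itv.
  split; split => // k kj; have := h k (leqW kj); rewrite /B.
  case: ifPn => [ki _|_]; first by rewrite (le_trans (Xx _ ki))// ltW.
  by case: eqP => [->|_] //; rewrite kj /= in_itv.
rewrite (@prob_forall_mem _ B b).
- rewrite big_nat_recr//= (big_cat_nat (n := i.+1))//= big_nat_recr//=.
  rewrite {2}/b ltnn eqxx {3}/b ltnNge (ltnW ij)/= (gtn_eqF ij) ltnn.
  rewrite (eq_big_nat _ _ (F2 := fun=> F x)); last first.
    by move=> k /andP[_ ki]; rewrite /b ki.
  rewrite [X in _ * X * _](eq_big_nat _ _ (F2 := fun=> F y)); last first.
    move=> k /andP[ik kj]; rewrite /b ltnNge (ltnW ik)/= (gtn_eqF ik).
    by rewrite kj.
  by rewrite !prodr_const_nat subn0.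
- by move=> k; rewrite /B; do 3 case: ifP => // _.
- move=> k; rewrite /B /b; case: ifP => _; first by rewrite preim_le.
  case: ifP => _; first by rewrite prob_preim_itv// ltW.
  by case: ifP => _; [rewrite preim_le|exact: prob_preim_gt].
Qed.

(** Confines the inner integral to [x < y]: a first crossing of [y] at [j] forces [X i <= y], while
    the crossing of [x] at [i] needs [X i > x]. *)
Lemma record_atI0 i j x y : (0 < i)%N -> (i < j)%N -> y <= x ->
  record_at j y `&` record_at i x = set0.
Proof.
move=> i0 ij yx; have j0 : (0 < j)%N := leq_trans i0 (ltnW ij).
rewrite -subset0 => w [] /(record_atP _ _ j0)[Xy _] /(record_atP _ _ i0)[_].
by rewrite ltNge (le_trans (Xy _ ij)).
Qed.

End partial_maxima.

(** * Moments and covariances of the spacings *)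

Section spacings.
Context d (T : measurableType d) (R : realType) (P : probability T R).
Variables (X : nat -> {RV P >-> R}) (F : R -> R).
Hypothesis indep : mutually_independent X.
Hypothesis XF : forall i x, P [set w | X i w <= x] = (F x)%:E.

Let F01 : forall x, 0 <= F x <= 1 := df_itv01 (XF 0).

Let ndF : {homo F : x y / x <= y} := df_nondecreasing (XF 0).

Lemma expectation_spacing i : (0 < i)%N ->
  ('E_P[spacing X i] = \int[lebesgue_measure]_x (F x ^+ i * (1 - F x))%:E)%E.
Proof.
move=> i0; rewrite unlock (integral_gap P).
- by apply: eq_integral => x _; exact: prob_record_at.
- exact: measurable_pmax.
- exact: measurable_pmax.
- exact: pmax_leS.
Qed.

(** [E Z_i] is compared with [E |X_0|] level by level: [F ^+ i * (1 - F)] is at most [F] at negative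
    levels and at most [1 - F] at the others. *)
Lemma Lfun1_spacing i : (0 < i)%N ->
  (X 0%N : T -> R) \in Lfun P 1 -> spacing X i \in Lfun P 1.
Proof.
move=> i0 X1; apply/Lfun1_integrable/integrableP; split.
  by apply/measurable_EFinP; exact: measurable_spacing.
under eq_integral do rewrite /= ger0_norm ?spacing_ge0//.
have := expectation_spacing i0; rewrite unlock => ->.
have /Lfun1_integrable/integrableP[_] := X1; apply: le_lt_trans.
(* [|X_0|] is the gap between [min(X_0, 0)] and [max(X_0, 0)], so it too is an integral over
   levels. *)
pose U w := Num.min (X 0%N w) 0; pose V w := Num.max (X 0%N w) 0.
have -> : (\int[P]_w `|(EFin \o X 0%N) w| = \int[P]_w (V w - U w)%:E)%E.
  apply: eq_integral => w _ /=; congr (_%:E); rewrite /U /V.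
  by case: leP => X0; [rewrite sub0r ler0_norm|rewrite subr0 gtr0_norm].
have mU : measurable_fun [set: T] U by exact: measurable_minr.
have mV : measurable_fun [set: T] V by exact: measurable_maxr.
rewrite (integral_gap P) //; last first.
  by move=> w; rewrite /U /V le_max ge_min ge_min !lexx !orbT.
apply: ge0_integral_mono => x.
  by have /andP[? ?] := F01 x; rewrite lee_fin mulr_ge0 ?exprn_ge0 ?subr_ge0.
have /andP[F0 F1] := F01 x.
have Fi1 : F x ^+ i <= 1 by exact: exprn_ile1.
have [x0|x0] := ltP x 0.
  apply: (@le_trans _ _ (F x)%:E).
    rewrite lee_fin -[leRHS]mulr1 ler_pM ?exprn_ge0 ?subr_ge0//; last lra.
    by rewrite -[leRHS]expr1 ler_wiXn2l.
  rewrite -(XF 0) le_measure ?inE//.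
  - by rewrite -[X in measurable X]setTI; exact: measurable_fun_le.
  - exact: (measurable_le_lt mU mV (measurable_cst x)).
  - by move=> w /= Xx; rewrite ge_min Xx lt_max x0 orbT.
apply: (@le_trans _ _ (1 - F x)%:E).
  by rewrite lee_fin ler_piMl ?subr_ge0.
rewrite -(prob_preim_gt XF 0) le_measure ?inE//.
- exact: measurable_funPTI.
- exact: (measurable_le_lt mU mV (measurable_cst x)).
- by move=> w /=; rewrite in_itv/= andbT => xX; rewrite ge_min x0 orbT lt_max xX.
Qed.

(** The left side is the inner integral of [E Z_i Z_j] at level [y]; factoring
    [F y ^+ j * (1 - F y)] out of the joint crossing probabilities leaves [A(y)]. *)
Lemma integral_spacing_record_at_le i j y : (0 < i)%N -> (i < j)%N ->
  log_concave_df F ->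
  ((exists x, F x = 1) -> P (X 0%N @^-1` [set inf [set x | F x = 1]]) = 0%E) ->
  (\int[P]_(w in record_at X j y) (spacing X i w)%:E <=
   (F y ^+ j * (1 - F y))%:E * 'E_P[spacing X i])%E.
Proof.
move=> i0 ij lcF atom; rewrite integral_mkcond.
have mj := measurable_record_at X j y.
have -> : (\int[P]_w ((fun w => (spacing X i w)%:E) \_ (record_at X j y)) w =
    \int[lebesgue_measure]_x P (record_at X j y `&` record_at X i x))%E.
  transitivity (\int[P]_w ((\1_(record_at X j y) w)%:E *
      (pmax X i.+1 w - pmax X i w)%:E))%E.
    apply: eq_integral => w _; rewrite patchE indicE.
    by case: ifP; rewrite ?mul1e ?mul0e.
  rewrite (integral_weighted_gap P).
  - apply: eq_integral => x _; rewrite integral_indic//.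
    exact: measurable_record_at.
  - exact/measurable_EFinP/measurable_indic.
  - exact: measurable_pmax.
  - exact: measurable_pmax.
  - by move=> w; rewrite lee_fin.
  - exact: pmax_leS.
have EZ0 : (0 <= 'E_P[spacing X i])%E.
  by rewrite unlock; apply: integral_ge0 => w _; rewrite lee_fin spacing_ge0.
have /andP[Fy0 Fy1] := F01 y.
have Fy_ge0 : 0 <= F y ^+ j * (1 - F y) by rewrite mulr_ge0 ?exprn_ge0 ?subr_ge0.
(* When [F y] is 0 or 1, all the joint probabilities vanish; otherwise division by [F y] makes
   sense. *)
have [Fy01|Fy01] := boolP (0 < F y < 1); last first.
  rewrite integral0_eq ?mule_ge0 ?lee_fin// => x _.
  have [yx|xy] := leP y x.
    by rewrite (record_atI0 _ i0 ij).
  rewrite (prob_record_atI indep XF)//.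
  move: Fy01; rewrite !lt_neqAle Fy0 Fy1 !andbT negb_and !negbK.
  case/orP => /eqP Fy; last by rewrite Fy subrr mulr0.
  have -> : F x = 0.
    by apply: le_anti; rewrite [leRHS]Fy ndF ?(ltW xy)//; case/andP: (F01 x).
  by rewrite expr0n (gtn_eqF i0) /= !mul0r.
have /andP[Fy_gt0 Fy_lt1] := Fy01.
apply: (@le_trans _ _ ((F y ^+ j * (1 - F y))%:E *
    \int[lebesgue_measure]_(x in `]-oo, y[)
      ((F x / F y) ^+ i * (1 - F x / F y))%:E)%E); last first.
  rewrite lee_wpmul2l ?lee_fin// expectation_spacing//.
  apply: le_integral_rescaled_df => //.
  exact: (df_intermediate (XF 0)).
have mF : measurable_fun [set: R] F by exact: nondecreasing_measurable.
rewrite -ge0_integralZl//=; last 2 first.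
- apply/measurable_EFinP/measurable_funTS; apply: measurable_funM.
    by apply: measurable_funX; apply: measurable_funM.
  by apply: measurable_funB => //; apply: measurable_funM.
- move=> x /=; rewrite in_itv/= => xy; rewrite lee_fin.
  have /andP[Fx0 _] := F01 x.
  rewrite mulr_ge0 ?exprn_ge0 ?divr_ge0// subr_ge0 ler_pdivrMr// mul1r.
  exact/ndF/ltW.
rewrite [leRHS]integral_mkcond le_eqVlt; apply/orP; left; apply/eqP.
apply: eq_integral => x _; rewrite patchE.
have -> : (x \in (`]-oo, y[%classic : set R)) = (x < y).
  by apply/idP/idP; rewrite !inE/= in_itv.
have [xy|yx] := ltP x y; last by rewrite (record_atI0 _ i0 ij)// measure0.
rewrite (prob_record_atI indep XF)// -EFinM; congr (_%:E).
(* The factors [F y ^+ i] and [F y] cancel the denominators of [(F x / F y) ^+ i] and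
   [1 - F x / F y]. *)
have -> : F y ^+ j = F y ^+ i * F y * F y ^+ (j - i.+1).
  by rewrite -exprSr -exprD subnKC.
rewrite expr_div_n; field.
by rewrite !gt_eqF ?exprn_gt0.
Qed.

Lemma covariance_spacing_lt_le0 i j : (0 < i)%N -> (i < j)%N ->
  (X 0%N : T -> R) \in Lfun P 1 -> log_concave_df F ->
  ((exists x, F x = 1) -> P (X 0%N @^-1` [set inf [set x | F x = 1]]) = 0%E) ->
  (covariance P (spacing X i) (spacing X j) <= 0)%E.
Proof.
move=> i0 ij X1 lcF atom; have j0 := leq_trans i0 (ltnW ij).
have Zi1 := Lfun1_spacing i0 X1; have Zj1 := Lfun1_spacing j0 X1.
have EZi := expectation_fin_num Zi1; have EZj := expectation_fin_num Zj1.
have mZi := measurable_spacing X i.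
have mZj := measurable_spacing X j.
have mF : measurable_fun [set: R] F by exact: nondecreasing_measurable.
have Fj_ge0 y : (0 <= (F y ^+ j * (1 - F y))%:E)%E.
  by have /andP[? ?] := F01 y; rewrite lee_fin mulr_ge0 ?exprn_ge0 ?subr_ge0.
have EZ0 : (0 <= 'E_P[spacing X i])%E.
  by rewrite unlock; apply: integral_ge0 => w _; rewrite lee_fin spacing_ge0.
(* [Z_j] is expanded as a gap with weight [Z_i], and the bound at each level [y] is integrated
   against the formula for [E Z_j]. *)
have EZZ : ('E_P[spacing X i * spacing X j] <=
    'E_P[spacing X i] * 'E_P[spacing X j])%E.
  rewrite {1}unlock.
  under eq_integral do rewrite EFinM.
  rewrite (integral_weighted_gap P).
  - rewrite (expectation_spacing j0) muleC -ge0_integralZr//; last first.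
      apply/measurable_EFinP/measurable_funM; first exact: measurable_funX.
      exact: measurable_funB.
    apply: ge0_integral_mono => y; last exact: integral_spacing_record_at_le.
    by apply: integral_ge0 => w _; rewrite lee_fin spacing_ge0.
  - exact/measurable_EFinP.
  - exact: measurable_pmax.
  - exact: measurable_pmax.
  - by move=> w; rewrite lee_fin spacing_ge0.
  - exact: pmax_leS.
rewrite covarianceE//; first by rewrite sube_le0.
(* The product is nonnegative, so [EZZ] and the finiteness of both means also give its
   integrability. *)
apply/Lfun1_integrable/integrableP; split.
  by apply/measurable_EFinP; exact: measurable_funM.
under eq_integral do rewrite /= ger0_norm ?mulr_ge0 ?spacing_ge0//.
move: EZZ; rewrite {1}unlock => /le_lt_trans; apply.
by rewrite ltey_eq fin_numM.
Qed.

End spacings.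

Theorem theorem4p2 (d : measure_display) (T : measurableType d) (R : realType)
    (P : probability T R) (X : nat -> {RV P >-> R}) (F : R -> R) :
  mutually_independent X ->
  (forall (i : nat) (x : R), P [set w | X i w <= x] = (F x)%:E) ->
  (X 0%N : T -> R) \in Lfun P 2%:E ->
  log_concave_df F ->
  ((exists x, F x = 1) -> P (X 0%N @^-1` [set inf [set x | F x = 1]]) = 0%E) ->
  forall n : nat, (2 <= n)%N ->
  forall i j : nat, (1 <= i <= n.-1)%N -> (1 <= j <= n.-1)%N -> i != j ->
  (covariance P (spacing X i) (spacing X j) <= 0)%E.
Proof.
move=> indep XF X2 lcF atom n _ i j /andP[i0 _] /andP[j0 _].
have X1 : (X 0%N : T -> R) \in Lfun P 1.
  by apply: Lfun_subset12 X2; exact: fin_num_measure.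
rewrite neq_ltn => /orP[ij|ji]; last rewrite covarianceC.
  exact: (covariance_spacing_lt_le0 indep XF).
exact: (covariance_spacing_lt_le0 indep XF).
Qed.
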